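(* For any tree $T$ of order $n\geq 3$, $\gamma_{tm}(T)\leq \lfloor 2n/3\rfloor$.
   Context: All graphs are non-empty, finite, undirected and simple. A total mixed dominating set of a graph $G=(V,E)$ with minimum degree at least $1$ is a set $S\subseteq V\cup E$ such that every element of $V\cup E$ (including those in $S$) is adjacent or incident to an element of $S$ (two vertices are adjacent if joined by an edge; two distinct edges are adjacent if they share an endpoint; a vertex and an edge are incident if the vertex is an endpoint of the edge; no element is adjacent or incident to itself). The total mixed domination number $\gamma_{tm}(G)$ is the minimum cardinality of a total mixed dominating set. *)

(* Defs.v *)
From HB Require Import structures.
From mathcomp Require Import all_boot.

Set Implicit Arguments.
Unset Strict Implicit.
Unset Printing Implicit Defensive.

Record sgraph := SGraph {
  vertex :> finType;
  adj : rel vertex;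
  adj_sym : symmetric adj;
  adj_irr : irreflexive adj;
  vertex_gt0 : 0 < #|vertex| }.

Definition edges (G : sgraph) : {set {set G}} :=
  [set [set xy.1; xy.2] | xy : G * G & adj xy.1 xy.2].

Definition edge (G : sgraph) : finType := {A : {set G} | A \in edges G}.

Definition elt (G : sgraph) : finType := (G + edge G)%type.

(* Total domination is with respect to this relation, which is irreflexive:
   no element of V + E dominates itself. *)
Definition mixed_adj (G : sgraph) (u v : elt G) : bool :=
  match u, v with
  | inl x, inl y => adj x y
  | inl x, inr a => x \in val a
  | inr a, inl x => x \in val a
  | inr a, inr b => (a != b) && (val a :&: val b != set0)
  end.

Definition total_mixed_dominating (G : sgraph) (S : {set elt G}) : bool :=
  [forall u, exists v in S, mixed_adj u v].

Definition degree (G : sgraph) (x : G) : nat := #|[set y | adj x y]|.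

Definition min_degree_ge1 (G : sgraph) : Prop := forall x : G, 0 < degree x.

(* Meaningful when the minimum degree of G is at least 1: then the whole of
   V + E is a total mixed dominating set, and gamma_tm G is the minimum
   cardinality of such a set; see gamma_tmP. *)
Definition gamma_tm (G : sgraph) : nat :=
  #|[arg min_(S < [set: elt G] | total_mixed_dominating S) #|S|]|.

Definition connected (G : sgraph) : Prop := forall x y : G, connect (@adj G) x y.

(* A cyclic sequence of two adjacent vertices is a ucycle, whence the bound. *)
Definition acyclic (G : sgraph) : Prop :=
  forall p : seq G, ucycle (@adj G) p -> size p < 3.

Definition tree (G : sgraph) : Prop := connected G /\ acyclic G.

Lemma edgesP (G : sgraph) (A : {set G}) :
  reflect (exists x y, adj x y /\ A = [set x; y]) (A \in edges G).
Proof.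
apply: (iffP imsetP) => [[[x y]] | [x [y [xy ->]]]].
  by rewrite inE /= => xy ->; exists x, y.
by exists (x, y); rewrite ?inE.
Qed.

Lemma mixed_adj_sym (G : sgraph) : symmetric (@mixed_adj G).
Proof.
by case=> [x|a] [y|b] //=; [rewrite adj_sym | rewrite eq_sym setIC].
Qed.

Lemma mixed_adj_irr (G : sgraph) : irreflexive (@mixed_adj G).
Proof. by case=> [x|a] /=; rewrite ?adj_irr ?eqxx. Qed.

Lemma total_mixed_dominatingT (G : sgraph) :
  min_degree_ge1 G -> total_mixed_dominating [set: elt G].
Proof.
move=> dG; apply/forallP=> -[x|[A eA]]; apply/existsP.
  have /card_gt0P[y] := dG x; rewrite inE => xy.
  by exists (inl y); rewrite inE.
have /edgesP[x [y [xy defA]]] := eA.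
by exists (inl x); rewrite inE /= defA !inE eqxx.
Qed.

Lemma gamma_tmP (G : sgraph) : min_degree_ge1 G ->
  (exists2 S : {set elt G}, total_mixed_dominating S & #|S| = gamma_tm G) /\
  (forall S : {set elt G}, total_mixed_dominating S -> gamma_tm G <= #|S|).
Proof.
move=> /total_mixed_dominatingT domT; rewrite /gamma_tm.
by case: arg_minnP => // S domS minS; split=> //; exists S.
Qed.

Lemma connected_min_degree_ge1 (G : sgraph) :
  connected G -> 1 < #|G| -> min_degree_ge1 G.
Proof.
move=> cG /card_gt1P[a [b [_ _ ab]]] x.
have [y yx] : exists y, y != x.
  by have [xa|] := eqVneq a x; [exists b; rewrite -xa eq_sym | exists a].
have /connectP[[|z p] /= xp def_y] := cG x y; first by rewrite def_y eqxx in yx.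
by apply/card_gt0P; exists z; rewrite inE; case/andP: xp.
Qed.

(* Main.v *)
Require Import Defs.
From mathcomp Require Import all_boot.
From mathcomp Require Import zify.

(** Why the bound holds.  Root the tree [T] at a leaf [r], let [c] be the only
neighbour of [r], and sort the vertices by their level modulo 3.  One of the
three classes, say class [k], contains at least a third of the vertices
([large_fibre]), so the set [A] of vertices outside class [k] has at most
[2n/3] elements.  Only vertices will be used, and a set of vertices is total
mixed dominating as soon as every vertex has a neighbour in it and every edge
has an end in it ([gamma_tm_le]).

The edges of a rooted tree join consecutive levels, so [A] meets every edge.
Moreover a vertex other than the root whose parent lies outside class [k] has
this parent as a neighbour in [A], and a vertex of class [k + 1] has all its
children in [A].  What goes wrong is the set [L] of the childless vertices of class [k + 1].
Replacing each of them by its parent cures this: the set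
[S = (A :\: L) :|: par @: L] is no larger than [A], it still meets every edge,
and every vertex but possibly the root has a neighbour in it
([pushed_cover], [pushed_total]).

If [c] is in [S], nothing is left to do.  As [c] has a child when [n >= 3],
the only bad case is that [c] is in class [k], which makes [r] an element of
[S], while no child of [c] is in [L].  Then exchanging [r] for [c] works: the
children of [c] are in [S] and dominate [c], which was the only vertex that
could depend on [r]. *)

Set Implicit Arguments.
Unset Strict Implicit.
Unset Printing Implicit Defensive.

(** * Dominating sets that consist of vertices *)

Lemma gamma_tm_le (G : sgraph) (D : {set G}) :
    (forall x, exists2 y, y \in D & adj x y) ->
    (forall x y, adj x y -> (x \in D) || (y \in D)) ->
  gamma_tm G <= #|D|.
Proof.
move=> totD coverD.
have degG : min_degree_ge1 G.
  by move=> x; have [y _ xy] := totD x; apply/card_gt0P; exists y; rewrite inE.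
rewrite -(card_imset (mem D) (@inl_inj G (edge G))).
apply: (gamma_tmP degG).2; apply/forallP=> -[x|[B eB]]; apply/existsP.
  by have [y Dy xy] := totD x; exists (inl y); rewrite imset_f.
have /edgesP[x [y [xy defB]]] := eB.
by case/orP: (coverD x y xy) => Dz;
  [exists (inl x) | exists (inl y)]; rewrite imset_f //= defB !inE eqxx ?orbT.
Qed.

Lemma large_fibre (T : finType) (m : nat) (f : T -> 'I_m.+1) :
  exists k, #|T| <= m.+1 * #|[set x | f x == k]|.
Proof.
apply/existsP; apply: contraT; rewrite negb_exists => /forallP small.
have cardT : #|T| = \sum_k #|[set x | f x == k]|.
  rewrite -sum1_card (partition_big f predT) //=; apply: eq_bigr => k _.
  by rewrite -sum1_card; apply: eq_bigl => x; rewrite inE.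
have: \sum_(k < m.+1) (m.+1 * #|[set x | f x == k]|).+1
      <= \sum_(k < m.+1) #|T|.
  by apply: leq_sum => k _; rewrite ltnNge small.
rewrite (eq_bigr (fun k => m.+1 * #|[set x | f x == k]| + 1)); last first.
  by move=> k _; rewrite addn1.
rewrite big_split /= -big_distrr /= -cardT !sum_nat_const card_ord.
by rewrite muln1 addnS ltnNge leq_addr.
Qed.

(** * Rooted trees *)

(** Deleting the edge [xy] of an acyclic graph separates its ends: a path that
avoids it would close up with it to a cycle. *)
Lemma acyclic_bridge (G : sgraph) (x y : G) (e : rel G) :
    acyclic G -> adj x y -> subrel e (@adj G) -> ~~ e x y ->
  ~~ connect e x y.
Proof.
move=> acG xy sub_e exy; apply/connectP=> -[p].
case/shortenP=> q qP uniq_q _ def_y {p}.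
have: ucycle (@adj G) (x :: q).
  by rewrite /ucycle uniq_q /= rcons_path (sub_path sub_e qP) -def_y adj_sym xy.
move/acG; case: q => [|z [|? ?]] //= in qP def_y uniq_q *.
  by rewrite def_y adj_irr in xy.
by move: exy; rewrite def_y; case/andP: qP => ->.
Qed.

(** The distance to the root, of which only the existence of a neighbour one
step closer to the root is recorded. *)
Lemma level_exists (G : sgraph) (r : G) : connected G ->
  exists lev : G -> nat, lev r = 0 /\
    forall x, x != r -> exists y, adj x y && (lev x == (lev y).+1).
Proof.
move=> cG.
pose walk x n := [exists p : n.-tuple G, path (@adj G) r p && (last r p == x)].
have walkP x (p : seq G) : path (@adj G) r p -> last r p = x ->
    walk x (size p).
  by move=> rp <-; apply/existsP; exists (in_tuple p); rewrite rp eqxx.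
have has_walk x : exists n, walk x n.
  by have /connectP[p rp ->] := cG r x; exists (size p); apply: walkP.
exists (fun x => ex_minn (has_walk x)); split.
  by case: ex_minnP => n _ /(_ 0 (walkP r [::] isT erefl)); case: n.
move=> x; case: ex_minnP => n /existsP[[p /= /eqP szp] /andP[rp /eqP lx]] minx xr.
case/lastP: p szp rp lx => [|p z] szp rp lx; first by rewrite -lx eqxx in xr.
rewrite last_rcons in lx; subst z; rewrite size_rcons in szp.
move: rp; rewrite rcons_path => /andP[rp px].
exists (last r p); rewrite adj_sym px /=.
case: ex_minnP => m /existsP[[q /= /eqP szq] /andP[rq /eqP lq]].
move=> /(_ _ (walkP _ _ rp erefl)) lemp; rewrite -szp eqSS eqn_leq lemp andbT.
rewrite -ltnS szp -szq -(size_rcons q x); apply: minx.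
by apply: walkP; rewrite ?last_rcons // rcons_path rq lq.
Qed.

(** The value of [par] at the root is arbitrary. *)
Definition rooting (G : sgraph) (r : G) (lev : G -> nat) (par : G -> G) :=
  [/\ lev r = 0,
      forall x, x != r -> adj x (par x) /\ lev x = (lev (par x)).+1
    & forall x y, adj x y -> (x != r /\ par x = y) \/ (y != r /\ par y = x)].

(** Any edge that did not join a vertex to its parent could be bypassed by
climbing from both of its ends to the root. *)
Lemma tree_rooting (G : sgraph) (r : G) : tree G ->
  exists lev par, rooting r lev par.
Proof.
move=> [cG acG]; have [lev [lev_r closer]] := level_exists r cG.
pose par x := odflt x [pick y | adj x y && (lev x == (lev y).+1)].
have parP x : x != r -> adj x (par x) /\ lev x = (lev (par x)).+1.
  move=> /closer[y xy]; rewrite /par; case: pickP => [z|/(_ y)] /=.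
    by case/andP=> ? /eqP.
  by rewrite xy.
exists lev, par; split=> // x y.
wlog le_xy : x y / lev x <= lev y => [IH xy|xy].
  by case/orP: (leq_total (lev x) (lev y)) => /IH;
    [|rewrite adj_sym or_comm]; apply.
right; have yr : y != r.
  apply: contraL le_xy => /eqP y_r; rewrite y_r lev_r -ltnNge.
  by rewrite y_r in xy; have [|_ ->] := parP x; first by
    apply: contraTneq xy => ->; rewrite adj_irr.
split=> //; apply/eqP; apply: contraT => pyx.
pose e a b := adj a b && ([set a; b] != [set x; y]).
have sym_e : symmetric e by move=> a b; rewrite /e adj_sym setUC.
have climb z : connect e z r.
  have [m] := ubnP (lev z); elim: m z => // m IH z ltz.
  have [->|zr] := eqVneq z r; first exact: connect0.
  have [zp lz] := parP z zr; apply: connect_trans (IH (par z) _); last by lia.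
  apply/connect1; rewrite /e zp; apply/eqP => eq_zp.
  (* The edge from [z] to its parent is [xy] only if [z = y] and the parent
     is [x], because the level of [x] is at most that of [y]. *)
  have: z \in [set x; y] by rewrite -eq_zp set21.
  have: y \in [set z; par z] by rewrite eq_zp set22.
  have: x \in [set z; par z] by rewrite eq_zp set21.
  rewrite !inE => /orP[]/eqP xz /orP[]/eqP yz _.
  - by rewrite xz yz adj_irr in xy.
  - by rewrite xz yz in le_xy; lia.
  - by rewrite yz xz eqxx in pyx.
  - by rewrite xz yz adj_irr in xy.
suff: ~~ connect e x y.
  by rewrite (connect_trans (climb x)) // (sym_connect_sym sym_e) climb.
by apply: acyclic_bridge => //; [move=> a b /andP[] | rewrite /e eqxx andbF].
Qed.

(** A vertex of maximal level has no neighbour but its parent. *)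
Lemma tree_leaf (G : sgraph) : tree G -> 1 < #|G| ->
  exists r c : G, adj r c /\ forall y, adj r y -> y = c.
Proof.
move=> treeG G_gt1; have /card_gt0P[x0 _] := vertex_gt0 G.
have [lev [par [_ parP edgeP]]] := tree_rooting x0 treeG.
case: (@arg_maxnP G x0 predT lev isT) => r _ maxr.
have nbr_r y : adj r y -> par r = y.
  case/edgeP=> [[] //|[yx0 pyr]]; have [_] := parP y yx0.
  by have := maxr y isT; rewrite pyr; lia.
have /card_gt0P[c] := connected_min_degree_ge1 treeG.1 G_gt1 r.
by rewrite inE => rc; exists r, c; split=> // y /nbr_r <-; apply: nbr_r.
Qed.

(** Otherwise [r] and [c] would form a whole connected component. *)
Lemma leaf_support (G : sgraph) (r c : G) : connected G -> 2 < #|G| ->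
    adj r c -> (forall y, adj r y -> y = c) ->
  exists2 y, adj c y & y != r.
Proof.
move=> cG G_gt2 rc nbr_r.
have [/existsP[y /andP[]]|] := boolP [exists y, adj c y && (y != r)].
  by exists y.
rewrite negb_exists => /forallP nbr_c.
have clos : closed (@adj G) [set r; c].
  apply: intro_closed => [|x y xy]; first exact: sym_connect_sym (@adj_sym G).
  rewrite !inE => /orP[]/eqP xE; rewrite xE in xy.
    by rewrite (nbr_r y) // eqxx orbT.
  by have := nbr_c y; rewrite xy negbK => ->.
suff: #|G| <= #|[set r; c]| by rewrite cards2; case: (r != c); lia.
rewrite -cardsT subset_leq_card //; apply/subsetP => z _.
by rewrite -(closed_connect clos (cG r z)) set21.
Qed.

(** * Pushing childless vertices up to their parents *)

Definition childless (G : sgraph) (r : G) (par : G -> G) (x : G) :=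
  [forall y, (y != r) ==> (par y != x)].

Definition pushed_leaves (G : sgraph) (r : G) lev (par : G -> G) (k : nat) :=
  [set x | (lev x %% 3 == k.+1 %% 3) && childless r par x].

Definition pushed (G : sgraph) (r : G) lev (par : G -> G) (k : nat) : {set G} :=
  [set x | lev x %% 3 != k] :\: pushed_leaves r lev par k
    :|: par @: pushed_leaves r lev par k.

Section Pushed.

Variables (G : sgraph) (r : G) (lev : G -> nat) (par : G -> G) (k : nat).
Hypotheses (rootG : rooting r lev par) (k_lt3 : k < 3).

Local Notation A := [set x | lev x %% 3 != k].
Local Notation L := (pushed_leaves r lev par k).
Local Notation S := (pushed r lev par k).

Lemma card_pushed : #|S| <= #|A|.
Proof.
have sLA : L \subset A.
  by apply/subsetP=> x; rewrite !inE => /andP[/eqP-> _]; lia.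
apply: leq_trans (leq_card_setU _ _) _.
apply: leq_trans (leq_add (leqnn _) (leq_imset_card _ _)) _.
by rewrite cardsD (setIidPr sLA) subnK ?subset_leq_card.
Qed.

Lemma pushed_parent x : x \in L -> par x \in S.
Proof. by move=> Lx; rewrite inE imset_f ?orbT. Qed.

Lemma pushed_keep x : lev x %% 3 != k -> x \notin L -> x \in S.
Proof. by move=> Ax nLx; rewrite inE in_setD nLx inE Ax. Qed.

Lemma pushed_inner x y :
  y != r -> par y = x -> lev x %% 3 != k -> x \in S.
Proof.
move=> yr pyx Ax; apply: pushed_keep => //; rewrite inE negb_and.
by apply/orP; right; rewrite negb_forall; apply/existsP; exists y;
  rewrite yr pyx eqxx.
Qed.

Lemma pushed_cover x y : adj x y -> (x \in S) || (y \in S).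
Proof.
case: rootG => _ parP edgeP.
wlog [yr pyx] : x y / y != r /\ par y = x => [IH xy|_].
  by case: (edgeP x y xy) => /IH; [rewrite orbC adj_sym|]; apply.
have [_ ly] := parP y yr; rewrite pyx in ly.
have [Ly|nLy] := boolP (y \in L); first by rewrite -pyx pushed_parent.
have [Ay|nAy] := boolP (lev y %% 3 != k); first by rewrite (pushed_keep Ay) ?orbT.
by rewrite (pushed_inner yr pyx) //; lia.
Qed.

(** When the parent is missing from [S], it is in class [k], the vertex itself
is in class [k + 1] and has a child, and that child is in class [k + 2],
which lies wholly in [S]. *)
Lemma pushed_total x : x != r -> exists2 y, y \in S & adj x y.
Proof.
case: rootG => _ parP edgeP xr; have [xp lx] := parP x xr.
have [Lx|nLx] := boolP (x \in L).
  by exists (par x); rewrite ?pushed_parent.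
have [Ap|nAp] := boolP (lev (par x) %% 3 != k).
  by exists (par x); rewrite ?(pushed_inner xr).
have : ~~ childless r par x.
  by apply: contra nLx => nchild; rewrite inE nchild andbT; lia.
rewrite negb_forall => /existsP[y]; rewrite negb_imply negbK => /andP[yr /eqP pyx].
have [yp ly] := parP y yr; rewrite pyx in yp ly.
exists y; last by rewrite adj_sym.
by apply: pushed_keep; rewrite ?inE ?negb_and; lia.
Qed.

End Pushed.

Theorem theorem2p11 (T : sgraph) (n : nat) (treeT : tree T)
    (orderT : #|T| = n) (n_ge3 : 3 <= n) :
  gamma_tm T <= (2 * n) %/ 3.
Proof.
have T_gt2 : 2 < #|T| by rewrite orderT.
have [r [c [rc nbr_r]]] := tree_leaf treeT (ltnW T_gt2).
have [lev [par rootT]] := tree_rooting r treeT.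
have [lev_r parP edgeP] := rootT.
have [cr pcr] : c != r /\ par c = r.
  by case: (edgeP r c rc) => [[]|//]; rewrite eqxx.
have lev_c : lev c = 1 by have [_ ->] := parP c cr; rewrite pcr lev_r.
have [y cy yr] := leaf_support treeT.1 T_gt2 rc nbr_r.
have pyc : par y = c.
  by case: (edgeP c y cy) => [[_ py]|[] //]; rewrite -py pcr eqxx in yr.
have [_ lev_y] := parP y yr; rewrite pyc lev_c in lev_y.
have [k] := large_fibre (fun x => inord (lev x %% 3) : 'I_3).
have k_lt3 := ltn_ord k; set V := [set x | _] => large_V.
set S := pushed r lev par k.
have card_S : #|S| <= (2 * n) %/ 3.
  apply: leq_trans (card_pushed r lev par k_lt3) _.
  have -> : [set x | lev x %% 3 != k] = ~: V.
    by apply/setP=> x; rewrite !inE -val_eqE /= inordK ?ltn_mod.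
  by have := cardsC V; rewrite orderT in large_V *; lia.
have coverS := pushed_cover rootT k_lt3.
have totS := pushed_total rootT k_lt3.
apply: leq_trans card_S.
have [Sc|nSc] := boolP (c \in S).
  apply: gamma_tm_le => // x; have [->|] := eqVneq x r; last exact: totS.
  by exists c.
have kE : nat_of_ord k = 1.
  apply: contraNeq nSc => k1; apply: (pushed_inner yr pyc).
  by rewrite lev_c eq_sym.
have Sr : r \in S.
  by apply: pushed_keep; rewrite ?inE lev_r kE.
have Sy : y \in S.
  apply: pushed_keep; first by rewrite lev_y kE.
  by apply: contra nSc => /pushed_parent; rewrite pyc.
have <- : #|c |: (S :\ r)| = #|S|.
  by rewrite cardsU1 (cardsD1 r S) Sr in_setD1 (negbTE nSc) andbF.
apply: gamma_tm_le => [x | x z xz].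
  have [->|xr] := eqVneq x r; first by exists c; rewrite ?setU11.
  have [->|xc] := eqVneq x c; first by exists y; rewrite // in_setU1 in_setD1 yr Sy orbT.
  have [z Sz xz] := totS x xr; exists z; rewrite // in_setU1 in_setD1 Sz andbT.
  have [zr|] := eqVneq z r; last by rewrite orbT.
  by rewrite (nbr_r x) ?eqxx // -?zr adj_sym // zr in xc *.
have [xr|xr] := eqVneq x r.
  by rewrite xr in xz; rewrite (nbr_r z xz) setU11 orbT.
have [zr|zr] := eqVneq z r.
  by rewrite zr adj_sym in xz; rewrite (nbr_r x xz) setU11.
by rewrite !in_setU1 !in_setD1 xr zr /=; case/orP: (coverS x z xz) => ->; rewrite !orbT.
Qed.
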